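(* Let $\Gamma\curvearrowright\Sigma$ be a convergence group action of a virtually torsion-free hyperbolic group $\Gamma$ on a metrizable compact space $\Sigma$, and suppose that $\Lambda\subset\Sigma$ is a $\Gamma$-invariant compact subset which is equivariantly homeomorphic to the Gromov boundary $\partial_\infty\Gamma$. Then the action $\Gamma\curvearrowright\Sigma-\Lambda$ is cocompact provided that $\Sigma-\Lambda$ has finitely many path connected components.
   Context: An action by homeomorphisms of a discrete group $\Gamma$ on a compact metrizable space $\Sigma$ is a convergence action if for every sequence of pairwise distinct elements of $\Gamma$ there exist a subsequence $(\gamma_n)$ and points $\lambda_\pm\in\Sigma$ such that $\gamma_n|_{\Sigma-\{\lambda_-\}}\to\lambda_+$ uniformly on compacts. Hyperbolic means word hyperbolic in the sense of Gromov. *)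

(* Defs.v *)
From HB Require Import structures.
From mathcomp Require Import all_boot all_order all_algebra generic_quotient.
From mathcomp Require Import all_classical all_reals all_analysis.

Set Implicit Arguments.
Unset Strict Implicit.
Unset Printing Implicit Defensive.

Import Order.TTheory GRing.Theory Num.Theory.
Import numFieldNormedType.Exports.

Local Open Scope classical_set_scope.
Local Open Scope quotient_scope.
Local Open Scope group_scope.

Section VirtuallyTorsionFree.
Variable Gam : groupType.

Definition torsion_free (H : {pred Gam}) : Prop :=
  forall (h : Gam) (n : nat), h \in H -> (0 < n)%N -> h ^+ n = 1 -> h = 1.

Definition finite_index (H : {pred Gam}) : Prop :=
  finite_set [set [set g * h | h in [set` H]] | g in [set: Gam]].

Definition virtually_torsion_free : Prop :=
  exists H : groupClosed Gam, finite_index H /\ torsion_free H.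

End VirtuallyTorsionFree.

Section WordMetric.
Variable Gam : groupType.

Definition is_word (s w : seq Gam) : bool :=
  all (fun a => (a \in s) || (a^-1 \in s)) w.

Record fin_gen_set := FinGenSet {
  gens :> seq Gam;
  gensP : forall g : Gam,
    exists n, `[< exists w, [/\ is_word gens w, size w = n
                              & \prod_(a <- w) a = g] >]
}.

Variable S : fin_gen_set.

Definition word_length (g : Gam) : nat := ex_minn (gensP S g).

Definition word_dist (x y : Gam) : nat := word_length (x^-1 * y).

Lemma word_length_ex (g : Gam) : exists w,
  [/\ is_word S w, size w = word_length g & \prod_(a <- w) a = g].
Proof. by rewrite /word_length; case: ex_minnP => n /asboolP. Qed.

Lemma word_length_le (w : seq Gam) :
  is_word S w -> (word_length (\prod_(a <- w) a)%g <= size w)%N.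
Proof.
move=> Sw; rewrite /word_length; case: ex_minnP => n _; apply.
by apply/asboolP; exists w.
Qed.

Lemma word_dist_mull (g x y : Gam) :
  word_dist (g * x) (g * y) = word_dist x y.
Proof. by rewrite /word_dist invgM mulgA mulgVK. Qed.

Lemma word_distxx (x : Gam) : word_dist x x = 0%N.
Proof.
apply/eqP; rewrite -leqn0 /word_dist mulVg.
by have := @word_length_le [::] isT; rewrite big_nil.
Qed.

Lemma word_dist_triangle (x y z : Gam) :
  (word_dist x z <= word_dist x y + word_dist y z)%N.
Proof.
rewrite /word_dist.
have [u [Su <- pu]] := word_length_ex (x^-1 * y).
have [v [Sv <- pv]] := word_length_ex (y^-1 * z).
have -> : x^-1 * z = \prod_(a <- u ++ v) a.
  by rewrite big_cat /= pu pv mulgA mulgK.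
by rewrite -size_cat word_length_le // /is_word all_cat; apply/andP.
Qed.

Lemma word_length_inv_le (g : Gam) : (word_length g^-1 <= word_length g)%N.
Proof.
have [w [Sw <- <-]] := word_length_ex g.
have -> : (\prod_(a <- w) a)^-1 = \prod_(a <- rev [seq a^-1 | a <- w]) a.
  elim: w {Sw} => [|a w IH]; first by rewrite !big_nil invg1.
  by rewrite big_cons invgM IH /= rev_cons -cats1 big_cat big_seq1.
rewrite -[size w](size_map (fun a : Gam => a^-1)) -size_rev word_length_le //.
rewrite /is_word all_rev all_map; apply: sub_all Sw => a /=.
by rewrite invgK orbC.
Qed.

Lemma word_distC (x y : Gam) : word_dist x y = word_dist y x.
Proof.
have H a b : (word_dist a b <= word_dist b a)%N.
  have := word_length_inv_le (b^-1 * a).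
  by rewrite /word_dist invgM invgK.
by apply/eqP; rewrite eqn_leq !H.
Qed.

(* The Gromov product (x | y)_w in the word metric. *)
Definition gromov_product (w x y : Gam) : rat :=
  (((word_dist w x)%:R + (word_dist w y)%:R - (word_dist x y)%:R) / 2)%R.

Definition hyperbolic : Prop :=
  exists delta : rat, forall w x y z : Gam,
    (Num.min (gromov_product w x z) (gromov_product w z y) - delta
       <= gromov_product w x y)%R.

End WordMetric.

(* The points of the Gromov boundary are the geodesic rays of the Cayley graph
   issued from an arbitrary vertex (a ray is recorded by the vertices it
   visits), up to bounded distance.  Since Gam is discrete and rays are indexed
   by nat, pointwise convergence of rays is uniform convergence on compacts.
   The quotient topology agrees with the one obtained from the rays issued from
   a fixed vertex; allowing all initial vertices makes the action of Gam
   visible on representatives. *)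
Section GromovBoundary.
Variables (Gam : groupType) (S : fin_gen_set Gam).

Definition geodesic_ray : set {ptws nat -> discrete_topology Gam} :=
  [set r | forall m n, (m <= n)%N -> word_dist S (r m) (r n) = (n - m)%N].

Definition asymptotic (r r' : geodesic_ray) : bool :=
  `[< exists C : nat, forall n,
        (word_dist S (\val r n) (\val r' n) <= C)%N >].

Lemma asymptotic_refl : reflexive asymptotic.
Proof. by move=> r; apply/asboolP; exists 0%N => n; rewrite word_distxx. Qed.

Lemma asymptotic_sym : symmetric asymptotic.
Proof.
move=> r r'; apply/idP/idP => /asboolP[C HC]; apply/asboolP; exists C => n;
  by rewrite word_distC; exact: HC.
Qed.

Lemma asymptotic_trans : transitive asymptotic.
Proof.
move=> r2 r1 r3 /asboolP[C HC] /asboolP[D HD]; apply/asboolP.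
exists (C + D)%N => n.
exact: leq_trans (word_dist_triangle S _ (\val r2 n) _) (leq_add (HC n) (HD n)).
Qed.

Canonical asymptotic_equiv :=
  EquivRel asymptotic asymptotic_refl asymptotic_sym asymptotic_trans.

Definition gromov_boundary := quotient_topology {eq_quot asymptotic_equiv}.

HB.instance Definition _ := Topological.on gromov_boundary.
HB.instance Definition _ := Quotient.on gromov_boundary.

Lemma geodesic_ray_translate (g : Gam) (r : geodesic_ray) :
  geodesic_ray (fun n => g * \val r n).
Proof.
by move=> m n mn; rewrite word_dist_mull; exact: (set_mem (valP r)).
Qed.

Definition ray_translate (g : Gam) (r : geodesic_ray) : geodesic_ray :=
  exist _ (fun n => g * \val r n) (mem_set (geodesic_ray_translate g r)).

Definition boundary_act (g : Gam) (xi : gromov_boundary) : gromov_boundary :=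
  \pi_gromov_boundary (ray_translate g (repr xi)).

Lemma boundary_act_pi (g : Gam) (r : geodesic_ray) :
  boundary_act g (\pi_gromov_boundary r) =
  \pi_gromov_boundary (ray_translate g r).
Proof.
have /eqmodP/asboolP[C HC] :
  \pi_{eq_quot asymptotic_equiv} (repr (\pi_gromov_boundary r)) =
  \pi_{eq_quot asymptotic_equiv} r by exact: reprK.
apply/eqmodP/asboolP; exists C => n.
by rewrite /= word_dist_mull; exact: HC.
Qed.

End GromovBoundary.

Section Actions.
Variables (Gam : groupType).

Definition action_by_homeos (X : topologicalType) (act : Gam -> X -> X) : Prop :=
  [/\ forall x, act 1 x = x,
      forall g h x, act (g * h) x = act g (act h x)
    & forall g, continuous (act g)].

Definition convergence_action (X : uniformType) (act : Gam -> X -> X) : Prop :=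
  action_by_homeos act /\
  forall gam : nat -> Gam, injective gam ->
    exists (phi : nat -> nat) (lamm lamp : X),
      {homo phi : m n / (m < n)%N} /\
      {family [set K | compact K /\ K `<=` ~` [set lamm]],
        (fun n => act (gam (phi n))) @ \oo --> (fun=> lamp : X)}.

Definition invariant_set (X : Type) (act : Gam -> X -> X) (A : set X) : Prop :=
  forall g, act g @` A `<=` A.

(* Equivariant homeomorphism from X onto the invariant subset A of Y, where A
   carries the subspace topology (the canonical topology of A as a type). *)
Definition equivariantly_homeomorphic (X Y : topologicalType)
    (actX : Gam -> X -> X) (actY : Gam -> Y -> Y) (A : set Y) : Prop :=
  exists (f : X -> A) (f' : A -> X),
    [/\ continuous f, continuous f', cancel f f', cancel f' f
      & forall g x, \val (f (actX g x)) = actY g (\val (f x))].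

Definition cocompact_on (X : topologicalType) (act : Gam -> X -> X)
    (A : set X) : Prop :=
  exists K : set X, [/\ compact K, K `<=` A
    & A = \bigcup_(g in [set: Gam]) (act g @` K)].

End Actions.

Section PathComponents.
Variables (R : realType) (X : topologicalType).

Definition path_joined (A : set X) (x y : X) : Prop :=
  exists f : R -> X,
    [/\ {within `[0%R, 1%R]%classic, continuous f}, f 0%R = x, f 1%R = y
      & f @` `[0%R, 1%R]%classic `<=` A].

Definition path_component (A : set X) (x : X) : set X :=
  [set y | path_joined A x y].

Definition path_components (A : set X) : set (set X) :=
  [set path_component A x | x in A].

End PathComponents.

(* Main.v *)
Require Import Defs.
From HB Require Import structures.
From mathcomp Require Import all_boot all_order all_algebra generic_quotient.
From mathcomp Require Import all_classical all_reals all_analysis.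
From mathcomp Require Import finmap zify lra.

(** Every point of [Lambda] is conical, and this forces cocompactness off
    [Lambda].  Were the action not cocompact, then for each [e > 0] some [z]
    outside [Lambda] would have its whole orbit within [e] of [Lambda]
    (lemma [cocompact_of_escape]).  Such a [z] is then pursued along rays as if
    it were a boundary point.  Suppose that [h z] is close to the endpoint of a
    geodesic ray [s] from 1 opposite to [h]: a geodesic from [h] to 1 continued
    by [s] is almost geodesic.  Let [s'] be a ray
    from 1 to a point of [Lambda] within [e] of [h z].  Its endpoint is close to
    that of [s], so [s'] fellow-travels [s] for a fixed long time [m]; put
    [k := s' m].  By hyperbolicity [k^-1 h] is strictly longer than [h], the
    ray [k^-1 s'] is again opposite to it, and [(k^-1 h) z] is again close to the
    endpoint, [k] being one of finitely many elements.  Iterating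
    gives a sequence [h n] of lengths going to infinity with all [h n z] close
    to endpoints opposite to [h n] (lemma [pursuit]).

    The convergence property says the contrary: along a subsequence [h n] sends
    everything except one point of [Lambda] to a single point [lp], and [h n]
    times a suitable fixed boundary point is the endpoint of a ray passing near
    [h n].  So [lp] lies in the direction of [h n], at a definite distance from
    every endpoint opposite to [h n], whereas [h n z] converges to [lp] too
    (lemma [opposite_rays_leave_orbit]).

    Recognizing [lp] takes two boundary points different from the exceptional
    one, hence at least three boundary points.  A nonempty boundary has at least two
    (lemma [two_endpoints]), and if it is empty then so is [Lambda], and all of
    [Sigma] is a compact set whose translates cover.  If the boundary has exactly two, [a] and [b], the orbit of [z]
    tracks the orbit of the one next to [z], say [a]; the infinitely many
    elements fixing [a] and [b], and their inverses, then all contract the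
    complement of [b] towards [a], which is absurd
    (lemma [two_point_escape]).

    Hyperbolicity enters through the four-point inequality
    [d x y + d w z <= max (d x z + d w y) (d z y + d w x) + D] with an integer
    constant [D], which makes the geometric estimates linear arithmetic.
    Compactness of the space of rays ([ray_compactness]) turns continuity and
    injectivity of the boundary map into uniform statements. *)

Set Implicit Arguments.
Unset Strict Implicit.
Unset Printing Implicit Defensive.

Import Order.TTheory GRing.Theory Num.Theory.
Import metricType_numDomainType.

(** * Geodesics and the four-point inequality *)

Section FourPoint.
Variables (T : Type) (d : T -> T -> nat) (D : nat).
Hypothesis dC : forall x y, d x y = d y x.
Hypothesis dtri : forall x y z, d x z <= d x y + d y z.
Hypothesis four_point : forall w x y z,
  d x y + d w z <= maxn (d x z + d w y) (d z y + d w x) + D.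

Definition geodesic (r : nat -> T) :=
  forall m n, m <= n -> d (r m) (r n) = n - m.

(** Two applications of the four-point inequality with a far away time [N]: the
    first bounds [d (r N) (r' n)] by [N - n + D], whatever [C] is, and the
    second brings this estimate back to time [n]. *)
Lemma asymptotic_close (r r' : nat -> T) (C : nat) :
  geodesic r -> geodesic r' -> r 0 = r' 0 ->
  (forall n, d (r n) (r' n) <= C) -> forall n, d (r n) (r' n) <= 2 * D.
Proof.
move=> gr gr' r0 rC n.
pose N := C + 2 * n + D + 1.
have nN : n <= N by lia.
have [h1 h2] := (gr n N nN, gr' n N nN).
have [h3 h4] := (gr 0 n isT, gr' 0 n isT).
have [h5 h6] := (gr 0 N isT, gr' 0 N isT).
have h7 := rC N.
have h8 := four_point (r 0) (r N) (r' n) (r' N).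
have h9 := four_point (r 0) (r n) (r' n) (r N).
have := (dC (r' N) (r' n), dC (r N) (r n)).
rewrite r0 in h3 h5 h8 h9.
by case; lia.
Qed.

(** For [c] a geodesic segment from [c 0] to the far point [r n], this bounds the
    distance of [c] to [r] at times up to [n] independently of [n], so that a
    limit of such segments is asymptotic to [r]. *)
Lemma segment_close (r c : nat -> T) (n i : nat) :
  geodesic r -> i <= n ->
  d (c 0) (c i) = i -> d (c i) (r n) = d (c 0) (r n) - i -> i <= d (c 0) (r n) ->
  d (c i) (r i) <= d (c 0) (r 0) + D.
Proof.
move=> gr le_in h1 h2 h3.
have h4 := gr i n le_in; have h5 := gr 0 i isT; have h6 := gr 0 n isT.
have h7 := four_point (c 0) (c i) (r i) (r n).
have h8 := dtri (c 0) (r 0) (r i).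
have h9 := dtri (r 0) (c 0) (r n).
have [h10 h11] := (dC (r n) (r i), dC (r 0) (c 0)).
lia.
Qed.

(** Once the rays are more than [2 * D] apart, at a time [n], hyperbolicity keeps
    their Gromov product from growing past [n]. *)
Lemma nonasymptotic_diverge (r r' : nat -> T) :
  geodesic r -> geodesic r' -> r 0 = r' 0 ->
  ~ (forall n, d (r n) (r' n) <= 2 * D) ->
  exists C, forall i j, i + j <= d (r i) (r' j) + C.
Proof.
move=> gr gr' r0 nas.
have [n nd] : exists n, 2 * D < d (r n) (r' n).
  apply: contrapT => nex; apply: nas => n; rewrite leqNgt; apply/negP => h.
  by apply: nex; exists n.
exists (2 * n) => i j.
have h1 := gr 0 i isT; have h2 := gr' 0 j isT; have h3 := gr 0 n isT.
have h4 := gr' 0 n isT.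
rewrite r0 in h1 h3.
have h5 := dtri (r' 0) (r i) (r' j).
have h6 := dtri (r' 0) (r' j) (r i).
have h7 := dC (r i) (r' j).
have [lin|lni] := leqP i n; first lia.
have [ljn|lnj] := leqP j n; first lia.
have h8 := gr n i (ltnW lni); have h9 := gr' n j (ltnW lnj).
have h10 := four_point (r' 0) (r n) (r' n) (r i).
have h11 := four_point (r' 0) (r i) (r' n) (r' j).
have h12 := dC (r' j) (r' n).
lia.
Qed.

(** A point [k] has large Gromov product with at most one of two divergent rays. *)
Lemma opposite_one_of_two (o k : T) (r r' : nat -> T) (C : nat) :
  geodesic r -> geodesic r' -> r 0 = o -> r' 0 = o ->
  (forall i j, i + j <= d (r i) (r' j) + C) ->
  (forall i, d o k + i <= d k (r i) + (C + D)) \/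
  (forall i, d o k + i <= d k (r' i) + (C + D)).
Proof.
move=> gr gr' r0 r'0 opp.
apply: contrapT => /not_orP[] /existsNP[i] /negP ni /existsNP[j] /negP nj.
have h1 := gr 0 i isT; have h2 := gr' 0 j isT.
rewrite r0 in h1; rewrite r'0 in h2.
have h3 := four_point o (r i) (r' j) k.
have h4 := opp i j.
have h5 := dC k (r i).
lia.
Qed.

(** The path from [h] to [o] and then along [s] is almost geodesic; replacing [s]
    by a ray [s'] close to it at a large time [m] moves away from [h], and the
    four-point inequality for [h], [o], [s' m] and a later point of [s'] shows
    that the new path is almost geodesic with the same error [D].  Keeping the
    same error is what allows the step to be iterated. *)
Lemma pursuit_step (o h : T) (s s' : nat -> T) (m : nat) :
  geodesic s -> geodesic s' -> s 0 = o -> s' 0 = o -> 3 * D < m ->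
  (forall j, d o h + j <= d h (s j) + D) ->
  d (s m) (s' m) <= 2 * D ->
  d o h < d h (s' m) /\
  (forall j, d h (s' m) + j <= d h (s' (m + j)) + D).
Proof.
move=> gs gs' s0 s'0 m_large opp close.
have h1 := dtri h (s' m) (s m).
have h2 := dC (s m) (s' m).
have h3 := opp m.
split=> [|j]; first lia.
have h4 := gs' 0 m isT; have h5 := gs' 0 (m + j) isT.
have h6 := gs' m (m + j) (leq_addr _ _).
rewrite s'0 in h4 h5.
have h7 := four_point o h (s' m) (s' (m + j)).
have h8 := dC (s' (m + j)) (s' m).
lia.
Qed.

(** The ray [r] issued from [h] points away from [o], so a ray [t] from [o] with
    the same endpoint passes near [h]; a ray [s] leaving [o] opposite to [h] has
    therefore left [t] by time [m].  The three four-point inequalities bound in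
    turn the Gromov products at [o] of [s m] with [r N], with [t N] and with
    [t m], for a large [N]. *)
Lemma opposite_separated (o h : T) (s t r : nat -> T) (C C' m : nat) :
  geodesic s -> geodesic t -> geodesic r -> s 0 = o -> t 0 = o -> r 0 = h ->
  3 * D < m ->
  (forall j, d o h + j <= d h (s j) + D) ->
  (forall j, d o h + j <= d o (r j) + C) ->
  (forall j, d (t j) (r j) <= C') ->
  C + 2 * D < d o h ->
  2 * D < d (s m) (t m).
Proof.
move=> gs gt gr s0 t0 r0 m_large opp oppr as_tr h_large.
pose N := C' + C + 10 * D + m + d o h + 1.
have mN : m <= N by lia.
have h1 := gs 0 m isT; have h2 := gt 0 m isT; have h3 := gt 0 N isT.
have h4 := gt m N mN; have h5 := gr 0 N isT.
rewrite s0 in h1; rewrite t0 in h2 h3; rewrite r0 in h5.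
have h6 := opp m; have h7 := oppr N; have h8 := as_tr N.
have h9 := four_point o h (s m) (r N).
have h10 := four_point o (r N) (s m) (t N).
have h11 := four_point o (t N) (s m) (t m).
have [h12 h13 h14] := And3 (dC (r N) (t N)) (dC (t N) (t m)) (dC (t m) (s m)).
lia.
Qed.
End FourPoint.

Local Open Scope classical_set_scope.
Local Open Scope quotient_scope.

(** * Word metrics of hyperbolic groups *)

Section Word.
Local Open Scope group_scope.
Variables (Gam : groupType) (S : fin_gen_set Gam).
Local Notation d := (word_dist S).

Lemma hyperbolic_four_point : hyperbolic S -> exists D : nat, forall w x y z,
  (d x y + d w z <= maxn (d x z + d w y) (d z y + d w x) + D)%N.
Proof.
case=> delta hyp; exists (Num.bound (2 * delta)) => w x y z.
have := hyp w x y z; rewrite /gromov_product => {}hyp.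
have bd : (2 * delta <= (Num.bound (2 * delta))%:R)%R.
  have [neg|pos] := ltP (2 * delta)%R 0%R; last exact/ltW/archi_boundP.
  exact: le_trans (ltW neg) (ler0n _ _).
rewrite -(ler_nat rat) !natrD.
set B := (Num.bound _)%:R%R in bd *.
suff: ((d x y)%:R + (d w z)%:R <= (d x z)%:R + (d w y)%:R + B :> rat)%R
   \/ ((d x y)%:R + (d w z)%:R <= (d z y)%:R + (d w x)%:R + B :> rat)%R.
  rewrite -!natrD !ler_nat => -[] h; lia.
case: (leP _ ((((d w z)%:R + (d w y)%:R - (d z y)%:R) / 2)%R : rat)) hyp => _ hyp;
  [left|right]; lra.
Qed.

Lemma word_dist1 (g : Gam) : d 1 g = word_length S g.
Proof. by rewrite /word_dist invg1 mul1g. Qed.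

Lemma finite_ball (n : nat) : finite_set [set g : Gam | (d 1 g <= n)%N].
Proof.
pose L : seq Gam := 1 :: S ++ [seq a^-1 | a <- S].
elim: n => [|n IH].
  apply: (@sub_finite_set _ _ [set 1]); last exact: finite_set1.
  move=> g; rewrite /= word_dist1; have [w [_ <- <-]] := word_length_ex S g.
  by rewrite leqn0 => /nilP->; rewrite big_nil.
apply: sub_finite_set (finite_image2 (fun g a : Gam => g * a) IH (finite_seq L)).
move=> g /=; rewrite word_dist1.
have [w [Sw <- <-]] := word_length_ex S g.
case/lastP: w Sw => [|w a] Sw sw.
  by exists 1; [rewrite word_distxx|exists 1; rewrite ?big_nil ?mulg1 //= mem_head].
move: Sw; rewrite /is_word all_rcons => /andP[Sa Sw].
exists (\prod_(b <- w) b).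
  by rewrite word_dist1 (leq_trans (word_length_le Sw)) // -ltnS -(size_rcons w a).
exists a; last by rewrite -cats1 big_cat big_seq1.
rewrite /= inE mem_cat; case/orP: Sa => [->|Sa]; first by rewrite orbT.
by rewrite -[a]invgK map_f ?orbT.
Qed.

Lemma word_segment (g : Gam) : exists c : nat -> Gam,
  [/\ c 0%N = 1, c (d 1 g) = g & forall i j, (i <= j <= d 1 g)%N ->
    d (c i) (c j) = (j - i)%N].
Proof.
have [w [Sw sw pw]] := word_length_ex S g.
pose c i := \prod_(a <- take i w) a.
have c0 : c 0%N = 1 by rewrite /c take0 big_nil.
have cg : c (d 1 g) = g by rewrite /c word_dist1 -sw take_size.
exists c; split=> //.
have le_c i j : (i <= j <= d 1 g)%N -> (d (c i) (c j) <= j - i)%N.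
  rewrite word_dist1 => /andP[ij jg].
  have -> : (j - i = size (drop i (take j w)))%N by rewrite size_drop size_takel ?sw.
  have cij : c j = c i * \prod_(a <- drop i (take j w)) a.
    by rewrite /c -{1}(cat_take_drop i (take j w)) big_cat take_takel.
  rewrite /word_dist cij mulKg; apply: word_length_le.
  by apply/allP => a /mem_drop/mem_take; apply: (allP Sw).
move=> i j ijg; have h1 := le_c i j ijg.
have h2 := le_c 0%N i; have h3 := le_c j (d 1 g).
have h4 := word_dist_triangle S (c 0%N) (c i) (c (d 1 g)).
have h5 := word_dist_triangle S (c i) (c j) (c (d 1 g)).
have h6 : d (c 0%N) (c (d 1 g)) = d 1 g by rewrite c0 cg.
lia.
Qed.

End Word.

(** * Rays and their endpoints *)

(** The limit is read off an ultrafilter: it decides the value of each of the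
    coordinates, which have finite range, and each of its members is infinite. *)
Lemma konig (T : choiceType) (B : nat -> set T) (c : nat -> nat -> T) :
  (forall i, finite_set (B i)) -> (forall n i, B i (c n i)) ->
  exists (phi : nat -> nat) (l : nat -> T),
    forall i, (i <= phi i)%N /\ (forall j, (j <= i)%N -> c (phi i) j = l j).
Proof.
move=> finB cB.
have [U [uU ooU]] := @ultraFilterLemma _ (\oo : set_system nat) _.
have Uval i : exists x, U [set n | c n i = x].
  apply: contrapT => /forallNP nU.
  have : U [set n | forall x, x \in fset_set (B i) -> c n i <> x].
    have -> : [set n | forall x, x \in fset_set (B i) -> c n i <> x] =
      \bigcap_(x in [set` fset_set (B i)]) [set n | c n i <> x] by [].
    apply: filter_bigI => x _.
    by have [/nU|] := in_ultra_setVsetC [set n | c n i = x] uU.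
  move=> /filter_ex[n /(_ (c n i))]; apply=> //.
  by rewrite in_fset_set //; exact: mem_set.
have [l Ul] := choice Uval.
have : forall i, exists n, (i <= n)%N /\ (forall j, (j <= i)%N -> c n j = l j).
  move=> i.
  have : U [set n | forall j : 'I_i.+1, c n j = l j].
    by apply: filter_forall => j; apply: Ul.
  have /(ooU) Uge : \oo [set n | (i <= n)%N] by exists i.
  move=> /(filterI Uge)/filter_ex[n [/= len Hn]].
  by exists n; split=> // j; rewrite -ltnS => lej; apply: (Hn (Ordinal lej)).
by move=> /choice[phi Hphi]; exists phi, l.
Qed.

Section Rays.
Local Open Scope group_scope.
Variables (Gam : groupType) (S : fin_gen_set Gam).
Local Notation d := (word_dist S).
Local Notation ray := (geodesic_ray S).

Definition endpoint (r : ray) : gromov_boundary S := \pi_(gromov_boundary S) r.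

Lemma ray_geodesic (r : ray) : geodesic d (\val r).
Proof. exact: set_mem (valP r). Qed.

Definition mk_ray (r : nat -> Gam) (gr : geodesic d r) : ray :=
  exist _ (r : {ptws nat -> discrete_topology Gam}) (mem_set gr).

Lemma endpointP (r r' : ray) : endpoint r = endpoint r' <->
  exists C : nat, forall n, (d (\val r n) (\val r' n) <= C)%N.
Proof.
split; first by move=> /eqmodP/asboolP.
by move=> h; apply/eqmodP/asboolP.
Qed.

Lemma endpoint_translate (g : Gam) (r : ray) :
  endpoint (ray_translate g r) = boundary_act g (endpoint r).
Proof. by rewrite /endpoint boundary_act_pi. Qed.

Lemma endpoint_shift (m : nat) (r : ray) : exists r' : ray,
  (forall n, \val r' n = \val r (m + n)%N) /\ endpoint r' = endpoint r.
Proof.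
have gr : geodesic d (fun n => \val r (m + n)%N).
  by move=> i j ij; rewrite (ray_geodesic r) ?leq_add2l // subnDl.
exists (mk_ray gr); split=> //; apply/endpointP; exists m => n /=.
by rewrite word_distC (ray_geodesic r) ?leq_addl // addnK.
Qed.

Lemma ray_ball (r : ray) n : \val r 0%N = 1 -> d 1 (\val r n) = n.
Proof. by move=> <-; rewrite (ray_geodesic r) // subn0. Qed.

(** Stabilization of every coordinate is convergence for the pointwise topology
    on sequences of a discrete space. *)
Lemma continuous_ray_seq (Y : topologicalType) (F : ray -> Y) (s : nat -> ray) (r : ray) :
  continuous F -> (forall i j, (j <= i)%N -> \val (s i) j = \val r j) ->
  F \o s @ \oo --> F r.
Proof.
move=> cF sr; apply: continuous_cvg; first exact: cF.
have sv : (fun i => \val (s i)) @ \oo --> \val r.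
  apply/cvg_sup => N U [V] [[W] oW <-] WN WU.
  apply: (filterS WU); rewrite nbhs_simpl.
  by exists N => // i /= Ni; rewrite sr.
move=> U [V [[W oW <-] Wr WU]].
apply: filterS WU _; apply: sv.
by apply: open_nbhs_nbhs; split.
Qed.

Lemma endpoint_continuous : continuous endpoint.
Proof. exact: pi_continuous. Qed.

Section Hyperbolic.
Variable D : nat.
Hypothesis four_point : forall w x y z,
  (d x y + d w z <= maxn (d x z + d w y) (d z y + d w x) + D)%N.

Lemma based_asymptotic (r r' : ray) : \val r 0%N = 1 -> \val r' 0%N = 1 ->
  endpoint r = endpoint r' -> forall n, (d (\val r n) (\val r' n) <= 2 * D)%N.
Proof.
move=> r0 r'0 /endpointP[C rC].
apply: (asymptotic_close _ four_point (ray_geodesic r) (ray_geodesic r') _ rC).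
- exact: word_distC.
- by rewrite r0 r'0.
Qed.

(** The ray is a limit of geodesic segments from 1 to the points of a
    representative [q]; by hyperbolicity these segments stay close to [q]. *)
Lemma based_ray (xi : gromov_boundary S) :
  exists r : ray, \val r 0%N = 1 /\ endpoint r = xi.
Proof.
have [q qxi] : exists q : ray, endpoint q = xi by exists (repr xi); exact: reprK.
pose p := \val q 0%N.
have seg n := word_segment S (\val q n).
have /choice[c Hc] := seg.
have far n : (n <= d 1 (\val q n) + d 1 p)%N.
  have := ray_geodesic q (leq0n n); rewrite subn0 => {1}<-.
  by rewrite addnC [d 1 p]word_distC word_dist_triangle.
(* Segments are made constant after their end, to get sequences on nat. *)
have := @konig _ (fun i => [set g : Gam | (d 1 g <= i)%N])
  (fun n i => c n (minn i (d 1 (\val q n)))) (finite_ball S).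
case=> [n i /=|phi [l Hl]].
  have [<- _ cn] := Hc n.
  by rewrite cn /=; lia.
have gl : geodesic d l.
  move=> i j ij; pose k := phi (j + d 1 p)%N.
  have [kj lk] := Hl (j + d 1 p)%N; have fk := far k.
  have jk : (j <= d 1 (\val q k))%N by rewrite /k in fk *; lia.
  rewrite -!lk; try lia.
  have [_ _ cn] := Hc k; rewrite -/k (minn_idPl jk) (minn_idPl (leq_trans ij jk)).
  by rewrite cn // ij.
exists (mk_ray gl); split.
  have [_ /(_ 0%N (leq0n _))/= <-] := Hl 0%N; rewrite min0n.
  by have [] := Hc (phi 0%N).
rewrite -qxi; apply/endpointP; exists (d 1 p + D)%N => i /=.
pose k := phi (i + d 1 p)%N.
have [ki lk] := Hl (i + d 1 p)%N; have fk := far k.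
have ik : (i <= d 1 (\val q k))%N by rewrite /k in fk *; lia.
rewrite -lk; last lia.
have [c0 ck cn] := Hc k; rewrite -/k (minn_idPl ik) -{1}c0.
apply: (segment_close (word_distC S) (word_dist_triangle S) four_point (n := k)).
- exact: ray_geodesic.
- by rewrite /k; lia.
- by rewrite cn ?subn0.
- by rewrite -{1}ck cn ?ik ?leqnn // c0.
- by rewrite c0.
Qed.

End Hyperbolic.
End Rays.

Local Open Scope ring_scope.

(** * Convergence actions *)

Section MetricSpace.
Variables (R : realType) (X : metricType R).

Lemma closed_away (e : R) (A : set X) :
  closed [set x | forall y, A y -> e <= mdist x y].
Proof.
move=> x clx y Ay; rewrite leNgt; apply/negP => xy.
have gap : 0 < e - mdist x y by rewrite subr_gt0.
have [x' [/= /(_ y Ay) ex' ]] := clx _ (nbhsx_ballx x _ gap).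
rewrite ballEmdist /= => xx'.
have := metric_triangle x' x y; rewrite (metric_sym x' x); lra.
Qed.

Lemma uniformly_continuous_on_compact (f : X -> X) (e : R) :
  compact [set: X] -> continuous f -> 0 < e ->
  exists2 t, 0 < t & forall x y, mdist x y < t -> mdist (f x) (f y) < e.
Proof.
move=> cX cf e0.
pose P t x := forall y, mdist x y < t -> mdist (f x) (f y) < e.
have cover x : [set: X] x -> \forall x' \near x & t \near 0^'+, P t x'.
  move=> _.
  have e20 : 0 < e / 2 by rewrite divr_gt0.
  have near_x : nbhs x [set x' | mdist (f x) (f x') < e / 2].
    exact: cvgr_dist_lt (cf x) _ e20.
  have [t /= t0] := (nbhs_ballP _ _).1 near_x.
  rewrite ballEmdist => Ht.
  exists ([set x' | mdist x x' < t / 2], [set u | u < t / 2]); first split.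
  - by apply/nbhs_ballP; exists (t / 2); rewrite /= ?ballEmdist ?divr_gt0.
  - by apply: nbhs_right_lt; rewrite divr_gt0.
  move=> [x' u] /= [xx' ut] y x'y.
  have h1 : mdist (f x) (f x') < e / 2 by apply: Ht => /=; lra.
  have h2 : mdist (f x) (f y) < e / 2.
    by apply: Ht => /=; have := metric_triangle x x' y; lra.
  by have := metric_triangle (f x') (f x) (f y); rewrite (metric_sym (f x') (f x)); lra.
have /compact_near_coveringP/(_ R 0^'+ P _ cover)[t /= t0 Ht] := cX.
exists (t / 2); first by rewrite divr_gt0.
move=> x y xy; apply: (Ht (t / 2)) => //=.
  by rewrite sub0r normrN gtr0_norm ?divr_gt0 //; lra.
by rewrite divr_gt0.
Qed.

Lemma finite_equicontinuous (I : choiceType) (F : set I) (f : I -> X -> X) (e : R) :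
  compact [set: X] -> (forall i, continuous (f i)) -> finite_set F -> 0 < e ->
  exists2 t, 0 < t & forall i x y, F i -> mdist x y < t -> mdist (f i x) (f i y) < e.
Proof.
move=> cX cf /finite_seqP[l ->] e0.
elim: l => [|i l [t t0 Ht]]; first by exists 1.
have [u u0 Hu] := uniformly_continuous_on_compact cX (cf i) e0.
exists (Num.min t u) => [|j x y /=]; first by rewrite lt_min t0.
rewrite inE lt_min => /orP[/eqP->|jl] /andP[xt xu]; first exact: Hu.
exact: Ht.
Qed.
End MetricSpace.

Section Action.
Variables (R : realType) (Gam : groupType) (X : metricType R) (act : Gam -> X -> X).

(** Uniform convergence to [lp] away from [lm], with explicit distances. *)
Definition attracts (g : nat -> Gam) (lm lp : X) : Prop :=
  forall (K : set X), compact K -> ~ K lm -> forall e, 0 < e ->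
    \forall n \near \oo, forall x, K x -> mdist lp (act (g n) x) < e.

Lemma convergence_attracts (g : nat -> Gam) : convergence_action act -> injective g ->
  exists (phi : nat -> nat) (lm lp : X),
    {homo phi : m n / (m < n)%N} /\ attracts (g \o phi) lm lp.
Proof.
move=> [_ cv] /cv[phi [lm [lp [mon cvl]]]]; exists phi, lm, lp; split=> // K cK Klm e e0.
have cvK : {uniform K, (fun n => act (g (phi n))) @ \oo --> (fun=> lp : X)}.
  move/fam_cvgP: cvl; apply; split=> // x Kx xlm.
  by apply: Klm; rewrite -xlm.
apply: (cvK [set h : X -> X | forall x, K x -> mdist lp (h x) < e]).
apply/uniform_nbhs; exists [set xy | ball xy.1 e xy.2]; split.
  by rewrite -entourage_ballE; exists e.
by move=> h /= Hh x Kx; have := Hh x Kx; rewrite ballEmdist.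
Qed.

Hypothesis cX : compact [set: X].
Hypothesis conv : convergence_action act.
Let actH : action_by_homeos act := conv.1.

Lemma actK (g : Gam) (x : X) : act g^-1%g (act g x) = x.
Proof. by case: actH => a1 aM _; rewrite -aM mulVg a1. Qed.

Lemma actVK (g : Gam) (x : X) : act g (act g^-1%g x) = x.
Proof. by rewrite -{1}[g]invgK actK. Qed.

Variable L : set X.
Hypothesis cL : compact L.
Hypothesis invL : invariant_set act L.

Lemma act_invariant (g : Gam) (x : X) : L x -> L (act g x).
Proof. by move=> Lx; apply: invL; exists x. Qed.

Lemma attracts_point (g : nat -> Gam) (lm lp x : X) (e : R) :
  attracts g lm lp -> x <> lm -> 0 < e ->
  \forall n \near \oo, mdist lp (act (g n) x) < e.
Proof.
move=> att xlm e0.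
have /(_ [set x] _ _ e e0) := att; case; [exact: compact_set1|exact: nesym|].
by move=> N _ HN; exists N => // n /HN; apply.
Qed.

(** Otherwise the whole invariant set [L] would collapse to the attracting point. *)
Lemma attracts_repeller (g : nat -> Gam) (lm lp a b : X) :
  attracts g lm lp -> L a -> L b -> a <> b -> L lm.
Proof.
move=> att La Lb ab; apply: contrapT => nLlm.
have e0 : 0 < mdist a b / 2 by rewrite divr_gt0 // mdist_gt0; apply/eqP.
have [N _ /(_ N (leqnn N)) HN] := att L cL nLlm _ e0.
have h1 := HN _ (act_invariant (g N)^-1%g La).
have h2 := HN _ (act_invariant (g N)^-1%g Lb).
rewrite !actVK in h1 h2.
by have := metric_triangle a lp b; rewrite (metric_sym a lp); lra.
Qed.

Lemma cocompact_of_escape (e : R) : 0 < e ->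
  (forall z, ~ L z -> exists g, forall y, L y -> e <= mdist (act g z) y) ->
  cocompact_on act (~` L).
Proof.
move=> e0 esc; exists [set x | forall y, L y -> e <= mdist x y]; split.
- exact: subclosed_compact (@closed_away _ _ e L) cX _.
- by move=> x /= Hx Lx; have := Hx x Lx; rewrite mdistxx leNgt e0.
apply/seteqP; split=> [z /esc[g Hg]|_ [g _ [x Hx <-]] Lgx].
  by exists g^-1%g => //; exists (act g z) => //; rewrite actK.
have := Hx _ (act_invariant g^-1%g Lgx).
by rewrite actK mdistxx leNgt e0.
Qed.

Section TwoPoints.
Variables (a b : X).
Hypothesis Lab : L = [set a; b].
Hypothesis ab : a <> b.

(** The images of [z] converge to [lp] and stay near [a], so [lp] is not [b]; the
    point [b], being fixed, can then only be the exceptional point [lm]. *)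
Lemma fixing_sequence_attracts (u : nat -> Gam) (z : X) (e : R) :
  injective u -> (forall n, act (u n) a = a) -> (forall n, act (u n) b = b) ->
  ~ L z -> e < mdist a b -> (forall n, mdist (act (u n) z) a < e) ->
  exists2 phi : nat -> nat, {homo phi : m n / (m < n)%N} & attracts (u \o phi) b a.
Proof.
move=> inju ua ub nLz eab uz.
have [phi [lm [lp [mon att]]]] := convergence_attracts conv inju.
exists phi => //.
have La : L a by rewrite Lab; left.
have Lb : L b by rewrite Lab; right.
have Llm := attracts_repeller att La Lb ab.
have limit x : x <> lm -> (forall n, act (u n) x = x) -> lp = x.
  move=> xlm ux; apply: contrapT => /eqP; rewrite -mdist_gt0 => d0.
  have [N _ /(_ N (leqnn N))] := attracts_point att xlm d0.
  by rewrite /= ux ltxx.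
have lmb : lm = b.
  apply: contrapT => /nesym blm; have lpb := limit b blm ub.
  have zlm : z <> lm by move=> zlm; apply: nLz; rewrite zlm.
  have d0 : 0 < mdist a b - e by rewrite subr_gt0.
  have [N _ /(_ N (leqnn N))] := attracts_point att zlm d0.
  have := metric_triangle a (act (u (phi N)) z) b; have := uz (phi N).
  by rewrite lpb /= !(metric_sym (act (u (phi N)) z)) (metric_sym b); lra.
by move: att; rewrite lmb (limit a) // lmb.
Qed.

(** The elements fixing [a] and [b] form a subgroup of index at most two.  Taking a
    sequence of these, and then a subsequence along which the inverses
    converge too, both attract to [a] off [b]: the first sends [z] close to
    [a], and the inverses must then send the result close to [a] as well,
    although they send it back to [z]. *)
Lemma two_point_escape (r : nat -> Gam) (z : X) (e : R) :
  injective r -> ~ L z -> 0 < e -> e < mdist a b ->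
  ~ (forall g, mdist (act g z) (act g a) < e).
Proof.
move=> injr nLz e0 eab near_a.
have ua_ub g : act g a = a -> act g b = b.
  move=> ga; have : L (act g b) by apply: act_invariant; rewrite Lab; right.
  rewrite Lab => -[gb|//]; case: ab.
  by rewrite -(actK g b) gb -{2}ga actK.
have [u [inju ua]] : exists u : nat -> Gam, injective u /\ forall n, act (u n) a = a.
  pose A := [set g | act g a = a].
  suff : infinite_set A.
    move=> /infiniteP/card_leP/unsquash f.
    exists (fun n => \val (f (to_setT n))); split=> [m n|n]; last first.
      exact: set_mem (valP (f _)).
    by move=> /val_inj/('inj_f (in_setT _) (in_setT _))/(congr1 \val).
  move=> finA; apply: infinite_nat.
  have finG : finite_set [set: Gam].
    have [[s sab]|nob] := pselect (exists s, act s a = b).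
      apply: (@sub_finite_set _ _ (A `|` (fun g => s * g)%g @` A)); last first.
        by rewrite finite_setU; split=> //; exact: finite_image.
      move=> g _; have : L (act g a) by apply: act_invariant; rewrite Lab; left.
      rewrite Lab => -[ga|gb]; [by left|right].
      exists (s^-1 * g)%g; last by rewrite mulgA mulgV mul1g.
      by case: actH => _ aM _; rewrite /A /= aM gb -sab actK.
    apply: sub_finite_set finA => g _.
    have : L (act g a) by apply: act_invariant; rewrite Lab; left.
    by rewrite Lab => -[//|gb]; case: nob; exists g.
  rewrite -(@preimage_setT _ _ r); apply: finite_preimage finG.
  by move=> m n _ _; exact: injr.
have ub n := ua_ub _ (ua n).
have uz n : mdist (act (u n) z) a < e by rewrite -{1}(ua n).
have [phi mon att] := fixing_sequence_attracts inju ua ub nLz eab uz.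
have injphi : injective phi.
  by move=> m n mn; apply/eqP; case: ltngtP (erefl (phi m)) => // /mon; rewrite mn ltnn.
pose v n := (u (phi n))^-1%g.
have vfix x : (forall n, act (u n) x = x) -> forall n, act (v n) x = x.
  by move=> ux n; rewrite -{1}(ux (phi n)) actK.
have injv : injective v by move=> m n /invg_inj/inju/injphi.
have va := vfix _ ua; have vb := vfix _ ub.
have vz n : mdist (act (v n) z) a < e by rewrite -{1}(va n).
have [psi mon' att'] := fixing_sequence_attracts injv va vb nLz eab vz.
have zb : 0 < mdist z b by rewrite mdist_gt0; apply/eqP => zb; apply: nLz; rewrite Lab; right.
have za : 0 < mdist a z by rewrite mdist_gt0; apply/eqP => za; apply: nLz; rewrite Lab; left.
pose t := Num.min (mdist z b) (mdist a b / 2).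
have ab0 : 0 < mdist a b / 2 by rewrite divr_gt0 // mdist_gt0; apply/eqP.
have t0 : 0 < t by rewrite lt_min zb.
pose K := [set x | forall y, [set b] y -> t <= mdist x y].
have cK : compact K by exact: subclosed_compact (@closed_away _ _ t _) cX _.
have Kb : ~ K b by move=> /(_ b erefl); rewrite mdistxx leNgt t0.
pose e' := Num.min (mdist a z) (mdist a b / 2).
have e'0 : 0 < e' by rewrite lt_min za.
have [N _ HN] := att K cK Kb e' e'0; have [N' _ HN'] := att' K cK Kb e' e'0.
pose n := maxn N N'.
have psin : (n <= psi n)%N.
  by elim: (n) => // k IH; apply: leq_ltn_trans IH (mon' _ _ (ltnSn k)).
have Kz : K z by move=> y ->; rewrite /t ge_min lexx.
have := HN (psi n) (leq_trans (leq_maxl _ _) psin) z Kz.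
set w := act _ z => wa.
have Kw : K w.
  move=> y ->; move: wa; rewrite lt_min => /andP[_ wa].
  rewrite /t ge_min; apply/orP; right.
  by have := metric_triangle a w b; lra.
have := HN' n (leq_maxr _ _) w Kw.
by rewrite /w /v /= actK lt_min ltxx.
Qed.

End TwoPoints.
End Action.

(** * Limits of rays *)

Section Limits.
Variables (Gam : groupType) (S : fin_gen_set Gam).
Local Notation d := (word_dist S).
Local Notation ray := (geodesic_ray S).

Lemma ray_compactness (s : nat -> ray) : (forall n, \val (s n) 0%N = 1%g) ->
  exists (phi : nat -> nat) (r : ray), \val r 0%N = 1%g /\
    forall i, (i <= phi i)%N /\
      forall j, (j <= i)%N -> \val (s (phi i)) j = \val r j.
Proof.
move=> s0.
have [] := @konig _ (fun i => [set g : Gam | (d 1%g g <= i)%N])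
  (fun n i => \val (s n) i) (finite_ball S).
  by move=> n i /=; rewrite ray_ball.
move=> phi [l Hl].
have gl : geodesic d l.
  move=> i j ij; have [_ Hj] := Hl j.
  by rewrite -!Hj // (ray_geodesic (s (phi j))).
exists phi, (mk_ray gl); split=> //=.
by have [_ /(_ 0%N isT) <-] := Hl 0%N; rewrite s0.
Qed.

Variable D : nat.
Hypothesis four_point : forall w x y z,
  (d x y + d w z <= maxn (d x z + d w y) (d z y + d w x) + D)%N.

(** Centring a ray [q] at its points [q n] and passing to the limit yields a
    bi-infinite geodesic; if all rays had the same endpoint, its two halves
    would be asymptotic. *)
Lemma two_endpoints (q : ray) : exists xi xi' : gromov_boundary S, xi <> xi'.
Proof.
apply: contrapT => /forallNP one.
have {}one (r r' : ray) : endpoint r = endpoint r'.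
  by apply: contrapT => h; apply: (one (endpoint r)); exists (endpoint r').
have [{}q [q0 _]] := based_ray four_point (endpoint q).
have [] := @konig _ (fun i => [set g : Gam | (d 1%g g <= i)%N])
  (fun n i => (\val q n)^-1 * \val q (n - i)%N)%g (finite_ball S).
  move=> n i /=; rewrite -(mulVg (\val q n)) word_dist_mull word_distC.
  by rewrite (ray_geodesic q) ?leq_subr //; lia.
move=> phi [l Hl].
have gl : geodesic d l.
  move=> i j ij; have [jk Hj] := Hl j.
  rewrite -!Hj // word_dist_mull word_distC (ray_geodesic q); lia.
(* The ray r is the forward half and l the backward half of the geodesic: at
   time i > D they are 2i apart, too far for a common endpoint. *)
pose i := (2 * D).+1; have [ik Hi] := Hl i; pose k := phi i.
have [r [Hr _]] := endpoint_shift k (ray_translate (\val q k)^-1%g q).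
have r0 : \val r 0%N = 1%g by rewrite Hr addn0 /= mulVg.
have l0 : \val (mk_ray gl) 0%N = 1%g by rewrite /= -Hi // subn0 mulVg.
have h1 := based_asymptotic four_point r0 l0 (one _ _) i.
have h2 : d (\val r i) (\val (mk_ray gl) i) = (2 * i)%N.
  rewrite /= -Hi // Hr /= word_dist_mull word_distC (ray_geodesic q) /k; lia.
lia.
Qed.
End Limits.

(** * Orbits near the image of the boundary *)

Section Main.
Variables (R : realType) (Gam : groupType) (S : fin_gen_set Gam).
Variables (X : metricType R) (act : Gam -> X -> X) (L : set X).
Local Notation d := (word_dist S).
Local Notation ray := (geodesic_ray S).

Variable D : nat.
Hypothesis four_point : forall w x y z,
  (d x y + d w z <= maxn (d x z + d w y) (d z y + d w x) + D)%N.
Hypothesis cX : compact [set: X].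
Hypothesis conv : convergence_action act.
Hypothesis cL : compact L.
Hypothesis invL : invariant_set act L.

Variable bd : gromov_boundary S -> X.
Hypothesis cbd : continuous bd.
Hypothesis injbd : injective bd.
Hypothesis bdL : forall y, L y <-> exists xi, bd xi = y.
Hypothesis equi : forall g xi, bd (boundary_act g xi) = act g (bd xi).

Definition fellow_travel (m : nat) (eta : R) : Prop := forall s t : ray,
  \val s 0%N = 1%g -> \val t 0%N = 1%g ->
  mdist (bd (endpoint s)) (bd (endpoint t)) <= eta ->
  (d (\val s m) (\val t m) <= 2 * D)%N.

(** By compactness of the space of rays from 1: rays with ever closer endpoints
    that are far apart at time [m] would subconverge to rays with the same
    endpoint, as [bd] is continuous and injective, still far apart at time
    [m]. *)
Lemma endpoint_separation (m : nat) : exists2 eta : R, 0 < eta & fellow_travel m eta.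
Proof.
apply: contrapT => noeta.
have bad (n : nat) : exists st : ray * ray,
    [/\ \val st.1 0%N = 1%g, \val st.2 0%N = 1%g,
     mdist (bd (endpoint st.1)) (bd (endpoint st.2)) <= n.+1%:R^-1 :> R
     & (2 * D < d (\val st.1 m) (\val st.2 m))%N].
  apply: contrapT => nst; apply: noeta; exists (n.+1%:R^-1 : R) => // s t s0 t0 st.
  by rewrite leqNgt; apply/negP => far; apply: nst; exists (s, t).
have {bad}[st Hst] := choice bad.
have [|phi [s [s0 Hs]]] := @ray_compactness _ S (fun n => (st n).1).
  by move=> n; have [] := Hst n.
have [|psi [t [t0 Ht]]] := @ray_compactness _ S (fun n => (st (phi n)).2).
  by move=> n; have [] := Hst (phi n).
have cF : continuous (bd \o @endpoint _ S).
  by move=> r; apply: continuous_comp; [exact: endpoint_continuous|exact: cbd].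
have lims : bd (endpoint (st (phi (psi i))).1) @[i --> \oo] --> bd (endpoint s).
  apply: (continuous_ray_seq (s := fun i => (st (phi (psi i))).1) cF).
  move=> i j ji; have [ipsi _] := Ht i; have [_ Hpsi] := Hs (psi i).
  by apply: Hpsi; exact: leq_trans ji ipsi.
have limt : bd (endpoint (st (phi (psi i))).2) @[i --> \oo] --> bd (endpoint t).
  apply: (continuous_ray_seq (s := fun i => (st (phi (psi i))).2) cF).
  by move=> i j ji; have [_ ->] := Ht i.
have st_eq : endpoint s = endpoint t.
  apply: injbd; apply: contrapT => /eqP; rewrite -mdist_gt0 => pos.
  have pos3 : 0 < mdist (bd (endpoint s)) (bd (endpoint t)) / 3 by rewrite divr_gt0.
  have [N1 _ H1] := cvgr_dist_lt lims pos3.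
  have [N2 _ H2] := cvgr_dist_lt limt pos3.
  have [N3 _ H3] : \forall n \near \oo,
      n.+1%:R^-1 < mdist (bd (endpoint s)) (bd (endpoint t)) / 3 :> R.
    exact: near_infty_natSinv_lt (PosNum pos3).
  pose i := maxn N1 (maxn N2 N3).
  have h1 := H1 i (leq_maxl _ _).
  have /H2 h2 : (N2 <= i)%N by rewrite /i; lia.
  have ik : (i <= phi (psi i))%N.
    by have [ii _] := Ht i; have [ij _] := Hs (psi i); exact: leq_trans ij.
  have /H3 : (N3 <= phi (psi i))%N by rewrite (leq_trans _ ik) // /i; lia.
  have [_ _ h3 _] := Hst (phi (psi i)).
  set x := bd (endpoint (st (phi (psi i))).1) in h1 h3.
  set y := bd (endpoint (st (phi (psi i))).2) in h2 h3.
  have h4 := metric_triangle (bd (endpoint s)) x (bd (endpoint t)).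
  have h5 := metric_triangle x y (bd (endpoint t)).
  rewrite (metric_sym y) in h5.
  by move=> h6; have := le_lt_trans h3 h6; lra.
have := based_asymptotic four_point s0 t0 st_eq m.
have [ipsi Hm] := Ht m; have [_ Hpsi] := Hs (psi m).
have [_ _ _] := Hst (phi (psi m)).
by rewrite Hm // Hpsi // ltnNge => /negP.
Qed.

(** The Gromov product at 1 of [h] with the points of [s] is at most [C / 2]. *)
Definition opposite (C : nat) (h : Gam) (s : ray) : Prop :=
  forall j, (d 1%g h + j <= d h (\val s j) + C)%N.

(** Of two boundary points other than the repelling point [lm], one, [w], is not
    in the direction of the inverse of [g := h (phi n)]; so [g w] lies in the
    direction of [g] and, [w] not being repelling, is close to [lp], like [g z].
    A ray opposite to [g] therefore has its endpoint far from [g z]. *)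
Lemma opposite_rays_leave_orbit (eta c0 : R) (z : X) (h : nat -> Gam) (s : nat -> ray)
    (x1 x2 x3 : gromov_boundary S) :
  fellow_travel (3 * D).+1 eta -> c0 < eta -> ~ L z ->
  x1 <> x2 -> x1 <> x3 -> x2 <> x3 ->
  (forall n, (n <= d 1%g (h n))%N) -> injective h ->
  (forall n, \val (s n) 0%N = 1%g) ->
  (forall n, opposite D (h n) (s n)) ->
  ~ (forall n, mdist (bd (endpoint (s n))) (act (h n) z) <= c0).
Proof.
move=> sep c0eta nLz x12 x13 x23 hn injh s0 opp near.
have [phi [lm [lp [mon att]]]] := convergence_attracts conv injh.
have L1 : L (bd x1) by apply/bdL; exists x1.
have L2 : L (bd x2) by apply/bdL; exists x2.
have Llm : L lm by apply: (attracts_repeller conv cL invL att L1 L2) => /injbd.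
have zlm : z <> lm by move=> zlm; apply: nLz; rewrite zlm.
have [x [y [xy xlm ylm]]] : exists x y, [/\ x <> y, bd x <> lm & bd y <> lm].
  have [e1|n1] := pselect (bd x1 = lm).
    by exists x2, x3; split=> //; rewrite -e1 => /injbd /esym.
  have [e2|n2] := pselect (bd x2 = lm).
    by exists x1, x3; split=> //; rewrite -e2 => /injbd /esym.
  by exists x1, x2.
have [rx [rx0 ex]] := based_ray four_point x.
have [ry [ry0 ey]] := based_ray four_point y.
have rxy : ~ (forall n, d (\val rx n) (\val ry n) <= 2 * D)%N.
  by move=> close; apply: xy; rewrite -ex -ey; apply/endpointP; exists (2 * D)%N.
have [C HC] := nonasymptotic_diverge (word_distC S) (word_dist_triangle S)
  four_point (ray_geodesic rx) (ray_geodesic ry) (etrans rx0 (esym ry0)) rxy.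
(* The two errors t around lp add up with c0 to eta. *)
pose t := (eta - c0) / 2.
have t0 : 0 < t by rewrite divr_gt0 // subr_gt0.
have [N1 _ H1] := attracts_point att zlm t0.
have [N2 _ H2] := attracts_point att xlm t0.
have [N3 _ H3] := attracts_point att ylm t0.
pose n := maxn (maxn N1 N2) (maxn N3 (C + D + 2 * D).+1).
have phin : (n <= phi n)%N.
  by elim: (n) => // k IH; apply: leq_ltn_trans IH (mon _ _ (ltnSn k)).
pose g := h (phi n).
have glarge : (C + D + 2 * D < d 1%g g)%N.
  by have := hn (phi n); rewrite -/g /n in phin *; lia.
have gz : mdist lp (act g z) < t by apply: (H1 n); rewrite /= /n; lia.
have gx : mdist lp (act g (bd x)) < t by apply: (H2 n); rewrite /= /n; lia.
have gy : mdist lp (act g (bd y)) < t by apply: (H3 n); rewrite /= /n; lia.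
have [w [rw [rw0 ew gw oppw]]] : exists w (rw : ray), [/\ \val rw 0%N = 1%g,
    endpoint rw = w, mdist lp (act g (bd w)) < t & opposite (C + D) g^-1%g rw].
  have [ox|oy] := opposite_one_of_two (word_distC S) four_point g^-1%g
    (ray_geodesic rx) (ray_geodesic ry) rx0 ry0 HC.
  - by exists x, rx.
  - by exists y, ry.
have [r [r0 er]] := based_ray four_point (boundary_act g w).
have [C' HC'] : exists C' : nat, forall n,
    (d (\val r n) (\val (ray_translate g rw) n) <= C')%N.
  by apply/endpointP; rewrite endpoint_translate er ew.
have : (2 * D < d (\val (s (phi n)) (3 * D).+1) (\val r (3 * D).+1))%N.
  apply: (opposite_separated (word_distC S) four_point (ray_geodesic _)
    (ray_geodesic r) (ray_geodesic (ray_translate g rw)) (s0 _) r0 _ (ltnSn _)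
    (opp (phi n)) _ HC' glarge).
  - by rewrite /= rw0 mulg1.
  - move=> j; have := oppw j; rewrite /= -/g.
    rewrite -(word_dist_mull S g 1%g g^-1%g) mulg1 mulgV word_distC.
    by rewrite -(word_dist_mull S g g^-1%g) mulgV.
rewrite ltnNge => /negP; apply; apply: sep => //.
have h1 := near (phi n); rewrite er equi -/g in h1 *.
have h2 := metric_triangle (bd (endpoint (s (phi n)))) (act g z) (act g (bd w)).
have h3 := metric_triangle (act g z) lp (act g (bd w)).
rewrite (metric_sym (act g z) lp) in h3.
by move: gz gw; rewrite /t => gz gw; lra.
Qed.

(** The sequences iterate the passage from a pair [(h, s)] to
    [(k^-1 h, k^-1 s')], where [s'] ends at a point of [L] near [h z] and [k] is
    its point at time [3 * D + 1], starting with [h = 1], to which every ray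
    is opposite. *)
Lemma pursuit (eta c0 e : R) (z : X) :
  fellow_travel (3 * D).+1 eta -> e <= c0 -> c0 + e <= eta ->
  (forall k x y, (d 1%g k <= (3 * D).+1)%N -> mdist x y < e ->
    mdist (act k x) (act k y) < c0) ->
  (forall g, exists2 y, L y & mdist y (act g z) < e) ->
  exists (h : nat -> Gam) (s : nat -> ray),
    [/\ injective h, forall n, (n <= d 1%g (h n))%N, forall n, \val (s n) 0%N = 1%g,
        forall n, opposite D (h n) (s n)
      & forall n, mdist (bd (endpoint (s n))) (act (h n) z) <= c0].
Proof.
move=> sep ec0 c0e cont near.
have approx g : exists s : ray, \val s 0%N = 1%g /\ mdist (bd (endpoint s)) (act g z) < e.
  have [y /bdL[xi <-] xiz] := near g.
  by have [s [s0 sxi]] := based_ray four_point xi; exists s; rewrite sxi.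
pose good (hs : Gam * ray) := [/\ \val hs.2 0%N = 1%g, opposite D hs.1 hs.2
  & mdist (bd (endpoint hs.2)) (act hs.1 z) <= c0].
have good0 : exists hs, good hs.
  have [s [s0 sz]] := approx 1%g; exists (1%g, s); split=> //=.
    by move=> j /=; rewrite word_distxx ray_ball // leq_addr.
  by apply: le_trans ec0; exact: ltW.
have step hs : exists hs', good hs -> good hs' /\ (d 1%g hs.1 < d 1%g hs'.1)%N.
  have [|ngood] := pselect (good hs); last by exists hs.
  case: hs => h s [/= s0 opp sz].
  have [s' [s'0 s'z]] := approx h.
  have close : (d (\val s (3 * D).+1) (\val s' (3 * D).+1) <= 2 * D)%N.
    apply: sep => //.
    have := metric_triangle (bd (endpoint s)) (act h z) (bd (endpoint s')).
    by rewrite (metric_sym (act h z)); lra.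
  pose m := (3 * D).+1; pose k := \val s' m.
  have [adv opp'] := pursuit_step (word_distC S) (word_dist_triangle S)
    four_point (ray_geodesic s) (ray_geodesic s') s0 s'0 (ltnSn _) opp close.
  have [s'' [Hs'' es'']] := endpoint_shift m (ray_translate k^-1%g s').
  have dk g : d 1%g (k^-1 * g)%g = d k g.
    by rewrite -(mulVg k) word_dist_mull.
  exists ((k^-1 * h)%g, s'') => _; split; last by rewrite /= dk (word_distC S k).
  split=> /=.
  - by rewrite Hs'' addn0 /= mulVg.
  - move=> j; rewrite Hs'' /= dk word_dist_mull word_distC.
    exact: opp'.
  rewrite es'' endpoint_translate equi.
  have [_ aM _] := conv.1; rewrite aM ltW // cont //.
  rewrite word_distC -(word_dist_mull S k) mulgV mulg1.
  by rewrite ray_ball.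
have [f Hf] := choice step; have [hs0 ghs0] := good0.
pose u n := iter n f hs0.
have gu n : good (u n).
  by elim: n => // n IH; have [] := Hf _ IH.
have uS n : (d 1%g (u n).1 < d 1%g (u n.+1).1)%N by have [] := Hf _ (gu n).
have umono : {homo (fun n => d 1%g (u n).1) : m n / (m < n)%N}.
  exact: homo_ltn ltn_trans uS.
exists (fun n => (u n).1), (fun n => (u n).2); split.
- move=> i j uij; apply/eqP; case: ltngtP (erefl (d 1%g (u i).1)) => // /umono.
    by rewrite uij ltnn.
  by rewrite uij ltnn.
- by elim=> // n IH; apply: leq_ltn_trans IH (uS n).
- by move=> n; have [] := gu n.
- by move=> n; have [] := gu n.
- by move=> n; have [] := gu n.
Qed.

(** By induction on word length: a generator moves points at distance less than
    [e] to points at distance less than [e1], so when the image of [z] has to be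
    [e]-close to [a] or [b], the gap between these leaves no choice. *)
Lemma orbit_tracks_translate (e e1 : R) (a b z : X) :
  L = [set a; b] -> e + e1 <= mdist a b ->
  (forall k x y, (d 1%g k <= 1)%N -> mdist x y < e -> mdist (act k x) (act k y) < e1) ->
  (forall g, exists2 y, L y & mdist y (act g z) < e) ->
  mdist a z < e -> forall g, mdist (act g a) (act g z) < e.
Proof.
move=> Lab sep cont near az g.
have [a1 aM _] := conv.1.
have [w [Sw _ <-]] := word_length_ex S g.
elim: w Sw => [|k w IH] /=; first by rewrite big_nil !a1.
rewrite /is_word /= => /andP[Sk Sw]; rewrite big_cons !aM.
set p := (\prod_(_ <- w) _)%g in IH *.
have k1 : (d 1%g k <= 1)%N.
  rewrite word_dist1 -[k]mulg1 -[leqRHS]/(size [:: k]).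
  have := @word_length_le _ S [:: k]; rewrite big_seq1 mulg1; apply.
  by rewrite /is_word /= Sk.
have h1 := cont k _ _ k1 (IH Sw).
have [c Lc cz] := near (k * p)%g; rewrite aM in cz.
have Lka : L (act k (act p a)).
  by do 2!apply: (act_invariant invL); rewrite Lab; left.
suff -> : act k (act p a) = c by [].
have h2 := metric_triangle c (act k (act p z)) (act k (act p a)).
rewrite (metric_sym (act k (act p z))) in h2.
have [ca ab'] := (metric_sym a b, sep).
move: Lc Lka; rewrite Lab => -[]cE -[]kE;
  rewrite cE kE in h1 h2 cz * => //; exfalso; clear cE kE Lab; lra.
Qed.


(** The ray [q] witnesses that the boundary is not empty.  The dichotomy is between
    at least three boundary points, where the pursuit applies, and exactly
    two. *)
Lemma orbits_escape (q : ray) : exists2 e, 0 < e &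
  forall z, ~ L z -> exists g, forall y, L y -> e <= mdist (act g z) y.
Proof.
have actc : forall g, continuous (act g) by case: conv.1.
have equicont n t : 0 < t -> exists2 e, 0 < e & forall k x y,
    (d 1%g k <= n)%N -> mdist x y < e -> mdist (act k x) (act k y) < t.
  exact: finite_equicontinuous cX actc (finite_ball S n).
suff [e e0 He] : exists2 e : R, 0 < e & forall z, ~ L z ->
    ~ (forall g, exists2 y, L y & mdist y (act g z) < e).
  exists e => // z /He noz; apply: contrapT => nog; apply: noz => g.
  apply: contrapT => noy; apply: nog; exists g => y Ly.
  by rewrite leNgt; apply/negP => gy; apply: noy; exists y; rewrite // metric_sym.
have [x [y xy]] := two_endpoints four_point q.
have [[w [wx wy]]|two] := pselect (exists w, w <> x /\ w <> y).
  have [eta eta0 sep] := endpoint_separation (3 * D).+1.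
  pose c0 := eta / 2; have c00 : 0 < c0 by rewrite divr_gt0.
  have [e' e'0 cont] := equicont (3 * D).+1 _ c00.
  exists (Num.min e' c0); first by rewrite lt_min e'0.
  move=> z nLz near.
  have [|||h [s [injh hn s0 opp close]]] := pursuit (c0 := c0) sep _ _ _ near.
  - by rewrite ge_min lexx orbT.
  - have : Num.min e' c0 <= c0 by rewrite ge_min lexx orbT.
    by rewrite /c0; lra.
  - by move=> k u v km; rewrite lt_min => /andP[uv _]; exact: cont.
  apply: (opposite_rays_leave_orbit sep _ nLz xy (nesym wx) (nesym wy) hn injh s0 opp close).
  by rewrite /c0; lra.
have Lab : L = [set bd x; bd y].
  apply/seteqP; split=> [u /bdL[w <-]|u [] ->];
    [|by apply/bdL; exists x|by apply/bdL; exists y].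
  have [->|wx] := pselect (w = x); [by left|right; congr bd].
  by apply: contrapT => wy; apply: two; exists w.
have xy' : bd x <> bd y by move/injbd.
pose t := mdist (bd x) (bd y) / 2.
have t0 : 0 < t by rewrite divr_gt0 // mdist_gt0; apply/eqP.
have [e' e'0 cont] := equicont 1%N _ t0.
pose e := Num.min e' t.
have [ee' et] : e <= e' /\ e <= t by rewrite !ge_min !lexx orbT.
have e0 : 0 < e by rewrite lt_min e'0.
exists e => // z nLz near.
have injq : injective (\val q).
  move=> i j qij; have := word_distxx S (\val q i); rewrite {2}qij.
  have [ij|ji] := leqP i j; first by rewrite (ray_geodesic q) //; lia.
  by rewrite word_distC (ray_geodesic q) ?(ltnW ji) //; lia.
have cont' k u v : (d 1%g k <= 1)%N -> mdist u v < e -> mdist (act k u) (act k v) < t.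
  by move=> k1 uv; apply: cont => //; exact: lt_le_trans ee'.
have tracks a b : L = [set a; b] -> mdist a b = 2 * t -> mdist a z < e ->  False.
  move=> Lab' abt az.
  have ab : a <> b by move=> E; move: abt; rewrite E mdistxx; lra.
  apply: (two_point_escape cX conv cL invL Lab' ab injq nLz e0); first by rewrite abt; lra.
  move=> g; rewrite metric_sym; apply: (orbit_tracks_translate Lab' _ cont' near az).
  by rewrite abt; lra.
have [a1 _ _] := conv.1.
have [u] := near 1%g; rewrite a1 {1}Lab => -[] -> uz.
  by apply: (tracks _ _ Lab) => //; rewrite /t; lra.
apply: (tracks (bd y) (bd x)) => //; first by rewrite Lab setUC.
by rewrite metric_sym /t; lra.
Qed.
End Main.

Theorem theorem1p9 (R : realType) (Gam : groupType) (S : fin_gen_set Gam)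
    (Sigma : metricType R) (act : Gam -> Sigma -> Sigma) (Lambda : set Sigma) :
  hyperbolic S ->
  virtually_torsion_free Gam ->
  compact [set: Sigma] ->
  convergence_action act ->
  compact Lambda ->
  invariant_set act Lambda ->
  equivariantly_homeomorphic (boundary_act (S := S)) act Lambda ->
  finite_set (path_components R (~` Lambda)) ->
  cocompact_on act (~` Lambda).
Proof.
move=> hyp _ cX conv cL invL [f [f' [cf _ fK f'K equi]]] _.
have [D four_point] := hyperbolic_four_point hyp.
have [L0|/set0P[y Ly]] := eqVneq Lambda set0.
  have [a1 _ _] := conv.1.
  exists [set: Sigma]; rewrite L0 setC0; split=> //.
  by apply/seteqP; split=> // z _; exists 1%g => //; exists z.
pose bd xi := \val (f xi).
have cbd : continuous bd.
  by move=> xi; apply: continuous_comp; [exact: cf|exact: initial_continuous].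
have injbd : injective bd by move=> xi xi' /val_inj/(can_inj fK).
have bdL u : Lambda u <-> exists xi, bd xi = u.
  split=> [Lu|[xi <-]]; last exact: set_mem (valP (f xi)).
  by exists (f' (exist _ u (mem_set Lu))); rewrite /bd f'K.
have [xi _] := (bdL y).1 Ly.
have [q _] := based_ray four_point xi.
have [e e0 esc] := orbits_escape four_point cX conv cL invL cbd injbd bdL equi q.
exact: cocompact_of_escape esc.
Qed.
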